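(* Consider a given ruleset, i.e. a collection of finite game trees, each with its edges partitioned into ordinary edges and special edges in such a way that every path from the root to a leaf contains at most one special edge. The positions $G$ of the ruleset are the vertices of these trees. For a position $G$ and a number $p\in\{0,1\}$ of tokens in the accompanying one-pile Nim component, let $\mathcal{G}_1(G,p)$, $\mathcal{G}_2(G,p)$, $\mathcal{G}_3(G,p)$ denote the SG values of $(G,p)$ under Rules 1, 2 and 3 (defined in the context), respectively, and let $\mathcal{G}(G)$ denote the ordinary normal-play SG value of $G$. Then the following two conditions are equivalent: (a) $\mathcal{G}_1(G,p)=\mathcal{G}_2(G,p)=\mathcal{G}(G)\oplus p$ holds for every position $G$ of the ruleset and every $p\in\{0,1\}$ (where the pair $(G,1)$ is considered only for those $G$ such that a special edge lies on the path from the root to $G$, these being the only $G$ for which $(G,1)$ can occur under Rule 2); (b) $\mathcal{G}_1(G,p)=\mathcal{G}_3(G,p)=\mathcal{G}(G)\oplus p$ holds for every position $G$ of the ruleset and every $p\in\{0,1\}$.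
   Context: All games are impartial and short. A game is given by its game tree, a finite rooted tree: positions are vertices, the options of a position $G$ are its children (write $G\to G'$ if $G'$ is an option of $G$), and terminal positions are leaves. For a finite set $S$ of nonnegative integers, $\mathrm{mex}(S)$ is the least nonnegative integer not in $S$. The (normal-play) SG value of a position is defined recursively by $\mathcal{G}(G)=\mathrm{mex}(\{\mathcal{G}(G')\mid G\to G'\})$; the ordinary/special distinction of edges plays no role in $\mathcal{G}(G)$. The symbol $\oplus$ is bitwise XOR of nonnegative integers. The edges of each game tree are partitioned into ordinary edges and special edges, so that every root-to-leaf path contains at most one special edge. A position of the combined game is a pair $(G,p)$, where $G$ is a vertex of the tree and $p\in\{0,1\}$ is the number of tokens in a one-pile Nim component. For a vertex $G$ let $S_1(G)$ be the set of its children reached by ordinary edges, and $S_2(G)$ the set of its children reached by special edges. The legal moves from $(G,p)$ are as follows. Rule 1 (ordinary disjunctive sum): move to $(G',p)$ for any $G'\in S_1(G)\cup S_2(G)$; and, if $p=1$, move to $(G,0)$. Rule 2 (based on misère play; the game starts at the root with $p=0$): move to $(G',p)$ for any $G'\in S_1(G)$; move to $(G',p+1)$ for any $G'\in S_2(G)$ (moving along a special edge adds one token); and, if $p=1$, move to $(G,0)$. Since play starts with no token and each path has at most one special edge, $p=1$ can occur only after a special edge has been traversed, and then no special edge lies below the current vertex; so the number of tokens never exceeds $1$. Rule 3 (based on play with a pass; the game starts at the root with $p=1$): move to $(G',p)$ for any $G'\in S_1(G)$; move to $(G',0)$ for any $G'\in S_2(G)$ (moving along a special edge also removes the token, if present);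 and, if $p=1$, move to $(G,0)$. For $i=1,2,3$, $\mathcal{G}_i(G,p)$ is the mex of the values $\mathcal{G}_i$ of all positions reachable from $(G,p)$ in one legal move under Rule $i$. *)

(* Defs.v *)
From Stdlib Require List.
From mathcomp Require Import all_boot.
Set Implicit Arguments.
Unset Strict Implicit.
Unset Printing Implicit Defensive.

Lemma mex_exists (s : seq nat) : exists n, n \notin s.
Proof.
exists (\max_(x <- s) x).+1; apply/negP => /(@leq_bigmax_seq _ _ predT id) h.
by have := h isT; rewrite ltnn.
Qed.

Definition mex (s : seq nat) : nat := ex_minn (mex_exists s).

(* [Node s1 s2]: the children in [s1] are reached by ordinary edges, those in
   [s2] by special edges.  A vertex of a tree is represented by the subtree
   hanging from it; what lies above the vertex is recorded by [vertex]. *)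
Inductive tree : Type := Node of seq tree & seq tree.

Definition S1 (G : tree) : seq tree := let: Node s1 _ := G in s1.
Definition S2 (G : tree) : seq tree := let: Node _ s2 := G in s2.

Definition leaf (G : tree) : Prop := S1 G = [::] /\ S2 G = [::].

(* [vertex T k G]: some path from the root of [T], containing exactly [k]
   special edges, ends at a vertex whose subtree is [G]. *)
Inductive vertex (T : tree) : nat -> tree -> Prop :=
| vertex_root : vertex T 0 T
| vertex_ordinary k G G' :
    vertex T k G -> List.In G' (S1 G) -> vertex T k G'
| vertex_special k G G' :
    vertex T k G -> List.In G' (S2 G) -> vertex T k.+1 G'.

Definition at_most_one_special (T : tree) : Prop :=
  forall k G, vertex T k G -> leaf G -> k <= 1.

Record ruleset := Ruleset {
  game_tree :> tree -> Prop;
  ruleset_special : forall T, game_tree T -> at_most_one_special T }.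

Fixpoint SG (G : tree) : nat :=
  let: Node s1 s2 := G in mex ([seq SG G' | G' <- s1] ++ [seq SG G' | G' <- s2]).

Definition nim_moves (G : tree) (p : nat) : seq (tree * nat) :=
  if p == 1 then [:: (G, 0)] else [::].

Definition rule1 (G : tree) (p : nat) : seq (tree * nat) :=
  [seq (G', p) | G' <- S1 G] ++ [seq (G', p) | G' <- S2 G] ++ nim_moves G p.

Definition rule2 (G : tree) (p : nat) : seq (tree * nat) :=
  [seq (G', p) | G' <- S1 G] ++ [seq (G', p.+1) | G' <- S2 G] ++ nim_moves G p.

Definition rule3 (G : tree) (p : nat) : seq (tree * nat) :=
  [seq (G', p) | G' <- S1 G] ++ [seq (G', 0) | G' <- S2 G] ++ nim_moves G p.

(* If [v q] lists the values of the positions reached from (G, q) by moving in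
   the tree component, then [mex (v 0)] is the value of (G, 0), and
   [add_nim v p] is the value of (G, p).  This presents the SG recursions below
   as structural recursions on [G]; lemmas [SG1E], [SG2E] and [SG3E] state them
   in the usual form, in terms of [rule1], [rule2] and [rule3]. *)
Definition add_nim (v : nat -> seq nat) (p : nat) : nat :=
  mex (v p ++ if p == 1 then [:: mex (v 0)] else [::]).

Fixpoint SG1 (G : tree) : nat -> nat :=
  let: Node s1 s2 := G in
  add_nim (fun p => [seq SG1 G' p | G' <- s1] ++ [seq SG1 G' p | G' <- s2]).

Fixpoint SG2 (G : tree) : nat -> nat :=
  let: Node s1 s2 := G in
  add_nim (fun p => [seq SG2 G' p | G' <- s1] ++ [seq SG2 G' p.+1 | G' <- s2]).

Fixpoint SG3 (G : tree) : nat -> nat :=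
  let: Node s1 s2 := G in
  add_nim (fun p => [seq SG3 G' p | G' <- s1] ++ [seq SG3 G' 0 | G' <- s2]).

Lemma SG_E G : SG G = mex [seq SG G' | G' <- S1 G ++ S2 G].
Proof. by case: G => s1 s2; rewrite map_cat. Qed.

Lemma SG1E G p : SG1 G p = mex [seq SG1 x.1 x.2 | x <- rule1 G p].
Proof.
case: G => s1 s2; rewrite /rule1 /nim_moves !map_cat -!map_comp /= /add_nim.
by rewrite -catA; case: (p == 1) => //=; rewrite /add_nim /= cats0.
Qed.

Lemma SG2E G p : SG2 G p = mex [seq SG2 x.1 x.2 | x <- rule2 G p].
Proof.
case: G => s1 s2; rewrite /rule2 /nim_moves !map_cat -!map_comp /= /add_nim.
by rewrite -catA; case: (p == 1) => //=; rewrite /add_nim /= cats0.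
Qed.

Lemma SG3E G p : SG3 G p = mex [seq SG3 x.1 x.2 | x <- rule3 G p].
Proof.
case: G => s1 s2; rewrite /rule3 /nim_moves !map_cat -!map_comp /= /add_nim.
by rewrite -catA; case: (p == 1) => //=; rewrite /add_nim /= cats0.
Qed.

(* Main.v *)
Require Import Defs.
From Stdlib Require Import PeanoNat.
From mathcomp Require Import all_boot.

(** Both conditions are equivalent to one and the same local condition, imposed
    at every vertex [G] of every tree of the ruleset.  Write [A] and [B] for the
    lists of normal-play values of the ordinary and of the special options of
    [G], and [flip x] for [x] XOR 1.  The condition, [balanced G], says that
    [mex (A ++ map flip B)] equals [mex (A ++ B)]: flipping the values behind
    the special edges does not change the value of [G].

    Rule 1 is an ordinary sum with a Nim pile, so the values it gives are always
    the predicted ones.  For the other two rules, suppose that the options of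
    [G] have the predicted values.  Under Rule 2 the options of [(G, 0)] then
    have the values [A ++ map flip B], so [(G, 0)] has the predicted value
    exactly when [G] is balanced; the position [(G, 1)] only matters after a
    special edge, where no special edge remains and Rule 2 is an ordinary sum.
    Under Rule 3 the position [(G, 0)] is normal play, and the options of
    [(G, 1)] have the values [map flip A ++ B ++ [:: mex (A ++ B)]], the last
    one coming from the Nim move.

    So everything rests on [mex_flip]: this last list has mex
    [flip (mex (A ++ B))] if and only if [G] is balanced.  Let [g] be
    [mex (A ++ B)].  The map [flip] exchanges the two elements of each pair
    [{2m, 2m+1}], so it preserves the set [I] of the numbers in the pairs
    strictly below the pair of [g].  Both mex equations turn out to say that
    [flip g] is not in [B], together with a covering condition: [I] is contained
    in [A ++ map flip B] in one case, and in [map flip A ++ B] in the other.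
    These two lists are exchanged by [flip], so the covering conditions agree. *)

(** * Flipping the lowest bit *)

Definition flip (x : nat) : nat := Nat.lxor x 1.

Lemma flipK : involutive flip.
Proof. by move=> x; rewrite /flip Nat.lxor_assoc Nat.lxor_nilpotent Nat.lxor_0_r. Qed.

Lemma flip_double n : flip n.*2 = n.*2.+1.
Proof.
have no_carry : Nat.land n.*2 1 = 0.
  (* here 1 is the mask [Nat.ones 1], which selects the lowest bit *)
  have -> : Nat.land n.*2 1 = Nat.modulo n.*2 2 by exact: (Nat.land_ones _ 1).
  by rewrite -muln2; apply: Nat.Div0.mod_mul.
by rewrite /flip -Nat.add_nocarry_lxor // Nat.add_1_r.
Qed.

Lemma flipE x : flip x = ~~ odd x + x./2.*2.
Proof.
rewrite -{1}(odd_double_half x); case: (odd x) => /=.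
  by rewrite add1n -flip_double flipK.
by rewrite !add0n flip_double.
Qed.

Lemma half_flip x : (flip x)./2 = x./2.
Proof. by rewrite flipE halfD odd_double andbF doubleK; case: (odd x). Qed.

Lemma flip_neq x : (flip x == x) = false.
Proof.
by rewrite flipE -[X in _ == X]odd_double_half eqn_add2r; case: (odd x).
Qed.

(** The half of a number indexes its pair.  In this form, the segments below [g]
    and below [flip g], each without the partner of its bound, are visibly the
    same set, stable under [flip]. *)
Lemma ltn_pair g x :
  (x < g) && (x != flip g) = (x./2 < g./2).
Proof.
case: (ltngtP x./2 g./2) => [lt_xg | gt_xg | eq_xg].
- have lt_xg' : x < g.
    by rewrite ltnNge; apply/negP => /half_leq; rewrite leqNgt lt_xg.
  rewrite lt_xg'; apply/eqP => def_x.
  by move: lt_xg; rewrite def_x half_flip ltnn.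
- by rewrite ltnNge; case: leqP => // /ltnW/half_leq; rewrite leqNgt gt_xg.
- rewrite flipE -(odd_double_half x) -[X in _ < X](odd_double_half g) eq_xg.
  by rewrite ltn_add2r eqn_add2r; case: (odd x); case: (odd g).
Qed.

Lemma ltn_pair_flip g x :
  (x < flip g) && (x != g) = (x./2 < g./2).
Proof. by rewrite -{2}(flipK g) ltn_pair half_flip. Qed.

Lemma mem_map_flip x s : (x \in map flip s) = (flip x \in s).
Proof. by rewrite -{1}(flipK x) mem_map //; apply: inv_inj flipK. Qed.

(** * Mex of flipped lists *)

Lemma mexP s n : mex s = n <-> n \notin s /\ (forall m, m < n -> m \in s).
Proof.
rewrite /mex; case: ex_minnP => g g_notin g_min; split=> [<- | [n_notin n_min]].
  split=> // m; apply: contraTT => /g_min; by rewrite -leqNgt.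
apply/eqP; rewrite eqn_leq g_min //= leqNgt.
by apply/negP => /n_min; apply/negP.
Qed.

(** Neither [g] nor [flip g] needs attention in the covering conditions: on the
    left [g] is the mex itself and [flip g], if it is below [g], is in [a]
    because it is not in [b]; on the right [g] is supplied by the last entry. *)
Lemma mex_flip a b :
  mex (a ++ map flip b) = mex (a ++ b) <->
  mex (map flip a ++ b ++ [:: mex (a ++ b)]) = flip (mex (a ++ b)).
Proof.
have [] := (mexP (a ++ b) _).1 erefl; move: (mex _) => g.
rewrite mem_cat negb_or => /andP[g_a g_b] g_min.
transitivity (flip g \notin b /\
    forall x, x./2 < g./2 -> (x \in a) || (flip x \in b)).
  rewrite mexP mem_cat mem_map_flip (negbTE g_a); split=> -[fg_b cover]; split=> //.
    move=> x; rewrite -ltn_pair => /andP[lt_xg _].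
    by have := cover x lt_xg; rewrite mem_cat mem_map_flip.
  move=> x lt_xg; rewrite mem_cat mem_map_flip.
  have [def_x | neq_x] := eqVneq x (flip g).
    have := g_min x lt_xg; rewrite mem_cat def_x (negbTE fg_b) orbF.
    by move=> ->.
  by apply: cover; rewrite -ltn_pair lt_xg.
rewrite mexP !mem_cat mem_map_flip flipK (negbTE g_a) mem_seq1 flip_neq orbF.
split=> -[fg_b cover]; split=> // x.
  move=> lt_xg; rewrite !mem_cat mem_map_flip mem_seq1.
  have [//|neq_x] := eqVneq x g; first by rewrite !orbT.
  rewrite orbF -{2}(flipK x); apply: cover.
  by rewrite half_flip -ltn_pair_flip lt_xg.
move=> lt_xg; have: (flip x)./2 < g./2 by rewrite half_flip.
rewrite -ltn_pair_flip => /andP[/cover + neq_x].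
by rewrite !mem_cat mem_map_flip flipK mem_seq1 (negbTE neq_x) orbF.
Qed.

(** The case without special options, where balance is automatic: adding a
    one-token Nim pile flips the value. *)
Lemma mex_flip_nim a : mex (map flip a ++ [:: mex a]) = flip (mex a).
Proof. by have [+ _] := mex_flip a [::]; rewrite /= !cats0 => /(_ erefl). Qed.

(** * Trees and their vertices *)

(** The automatic induction principle gives no hypothesis for the subtrees,
    since these are nested inside lists. *)
Lemma tree_options_ind (P : tree -> Prop) :
  (forall G, (forall G', List.In G' (S1 G) -> P G') ->
             (forall G', List.In G' (S2 G) -> P G') -> P G) ->
  forall G, P G.
Proof.
move=> step; fix IH 1 => -[s1 s2]; apply: step => /=.
  elim: s1 => [|G s1 IHs] G' /= => [[] | [<- | G'_s1]]; [exact: IH | exact: IHs].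
elim: s2 => [|G s2 IHs] G' /= => [[] | [<- | G'_s2]]; [exact: IH | exact: IHs].
Qed.

Lemma eq_map_In (T U : Type) (f g : T -> U) s :
  (forall x, List.In x s -> f x = g x) -> map f s = map g s.
Proof.
elim: s => //= x s IHs eq_fg; rewrite eq_fg; last by left.
by rewrite IHs // => y y_s; apply: eq_fg; right.
Qed.

Lemma leaf_below T k G :
  vertex T k G -> exists k' G', [/\ vertex T k' G', leaf G' & k <= k'].
Proof.
elim/tree_options_ind: G k => -[[|G1 s1] s2] IH1 IH2 k TG; last first.
  have G1_opt : List.In G1 (S1 (Node (G1 :: s1) s2)) by left.
  exact: IH1 G1_opt _ (vertex_ordinary TG G1_opt).
case: s2 => [|G2 s2] in IH1 IH2 TG *; first by exists k, (Node [::] [::]).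
have G2_opt : List.In G2 (S2 (Node [::] (G2 :: s2))) by left.
have [k' [L [TL leafL /ltnW le_k]]] := IH2 _ G2_opt _ (vertex_special TG G2_opt).
by exists k', L.
Qed.

(** A second special edge would lie on the path to some leaf. *)
Lemma no_special_below T k G :
  at_most_one_special T -> vertex T k G -> 0 < k -> S2 G = [::].
Proof.
move=> T1 TG k_gt0; case eqS2: (S2 G) => [//|G' s2].
have /leaf_below[k' [L [TL leafL le_k]]] : vertex T k.+1 G'.
  by apply: vertex_special TG _; rewrite eqS2; left.
by have := leq_trans le_k (T1 _ _ TL leafL); rewrite ltnS leqNgt k_gt0.
Qed.

(** * The three rules *)

Definition balanced (G : tree) : Prop :=
  mex (map SG (S1 G) ++ map flip (map SG (S2 G))) = SG G.

Lemma SG1_SG G : SG1 G 0 = SG G /\ SG1 G 1 = flip (SG G).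
Proof.
elim/tree_options_ind: G => G IH1 IH2.
have val0 : SG1 G 0 = SG G.
  rewrite SG1E SG_E /rule1 /nim_moves !map_cat -!map_comp /= cats0.
  by congr (mex (_ ++ _)); apply: eq_map_In => G' /=; [move=> /IH1[] | move=> /IH2[]].
split=> //; rewrite SG1E /rule1 /nim_moves !map_cat -!map_comp /= val0.
rewrite (@eq_map_In _ _ _ (flip \o SG)); last by move=> G' /IH1[].
rewrite (@eq_map_In _ _ _ (flip \o SG) (S2 G)); last by move=> G' /IH2[].
by rewrite !(map_comp flip SG) catA -!map_cat SG_E mex_flip_nim.
Qed.

Lemma SG2_0_balanced G :
  (forall G', List.In G' (S1 G) -> SG2 G' 0 = SG G') ->
  (forall G', List.In G' (S2 G) -> SG2 G' 1 = flip (SG G')) ->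
  SG2 G 0 = SG G <-> balanced G.
Proof.
move=> val1 val2; rewrite SG2E /rule2 /nim_moves !map_cat -!map_comp /= cats0.
rewrite (@eq_map_In _ _ _ SG (S1 G) val1).
by rewrite (@eq_map_In _ _ _ (flip \o SG) (S2 G) val2) map_comp.
Qed.

Lemma SG2_1_no_special G :
  S2 G = [::] -> (forall G', List.In G' (S1 G) -> SG2 G' 1 = flip (SG G')) ->
  SG2 G 0 = SG G -> SG2 G 1 = flip (SG G).
Proof.
move=> noS2 val1 val0; rewrite SG2E /rule2 /nim_moves noS2 /= map_cat -map_comp /=.
rewrite val0 (@eq_map_In _ _ _ (flip \o SG) (S1 G) val1) map_comp.
by rewrite SG_E noS2 cats0 mex_flip_nim.
Qed.

Lemma SG3_0 G : SG3 G 0 = SG G.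
Proof.
elim/tree_options_ind: G => G IH1 IH2.
rewrite SG3E SG_E /rule3 /nim_moves !map_cat -!map_comp /= cats0.
by congr (mex (_ ++ _)); apply: eq_map_In.
Qed.

Lemma SG3_1_balanced G :
  (forall G', List.In G' (S1 G) -> SG3 G' 1 = flip (SG G')) ->
  SG3 G 1 = flip (SG G) <-> balanced G.
Proof.
move=> val1; rewrite SG3E /rule3 /nim_moves !map_cat -!map_comp /= SG3_0.
rewrite (@eq_map_In _ _ _ (flip \o SG) (S1 G) val1) map_comp.
rewrite (@eq_map_In _ _ _ SG (S2 G)); last by move=> G' _; apply: SG3_0.
by rewrite /balanced !SG_E map_cat -mex_flip.
Qed.

(** The two values must be established together: the special options of a vertex
    with an empty pile are reached with one token, and below a special edge the
    Nim move leads back to the empty pile. *)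
Lemma balanced_SG2 T k G :
  at_most_one_special T -> (forall k G, vertex T k G -> balanced G) ->
  vertex T k G -> SG2 G 0 = SG G /\ (0 < k -> SG2 G 1 = flip (SG G)).
Proof.
move=> T1 balT; elim/tree_options_ind: G k => G IH1 IH2 k TG.
have IH1' G' (G'_S1 : List.In G' (S1 G)) := IH1 G' G'_S1 k (vertex_ordinary TG G'_S1).
have val0 : SG2 G 0 = SG G.
  apply/SG2_0_balanced; last exact: balT TG; first by move=> G' /IH1'[].
  by move=> G' G'_S2; have [_ ->] := IH2 G' G'_S2 _ (vertex_special TG G'_S2).
split=> // k_gt0; apply: SG2_1_no_special => //.
  exact: no_special_below T1 TG k_gt0.
by move=> G' /IH1'[_ ->].
Qed.

Lemma balanced_SG3_1 T k G :
  (forall k G, vertex T k G -> balanced G) ->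
  vertex T k G -> SG3 G 1 = flip (SG G).
Proof.
move=> balT; elim/tree_options_ind: G k => G IH1 _ k TG.
apply/SG3_1_balanced; last exact: balT TG.
by move=> G' G'_S1; apply: IH1 (vertex_ordinary TG G'_S1).
Qed.

Theorem theorem4 (R : ruleset) :
  (forall (T : tree) (k : nat) (G : tree) (p : nat),
      R T -> vertex T k G -> p = 0 \/ (p = 1 /\ 0 < k) ->
      SG1 G p = SG2 G p /\ SG2 G p = Nat.lxor (SG G) p)
  <->
  (forall (T : tree) (k : nat) (G : tree) (p : nat),
      R T -> vertex T k G -> p = 0 \/ p = 1 ->
      SG1 G p = SG3 G p /\ SG3 G p = Nat.lxor (SG G) p).
Proof.
transitivity (forall T k G, R T -> vertex T k G -> balanced G).
- split=> [val T k G RT TG | bal T k G p RT TG p01].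
    apply/SG2_0_balanced => [G' G'_S1 | G' G'_S2 |].
    + have [|_ ->] := val T k G' 0 RT (vertex_ordinary TG G'_S1); first by left.
      exact: Nat.lxor_0_r.
    + by have [|_ ->] := val T k.+1 G' 1 RT (vertex_special TG G'_S2); first by right.
    + by have [|_ ->] := val T k G 0 RT TG; [left | apply: Nat.lxor_0_r].
  have [SG1_0 SG1_1] := SG1_SG G.
  have [SG2_0 SG2_1] :=
    balanced_SG2 T k G (ruleset_special RT) (fun k G => bal T k G RT) TG.
  case: p01 => [-> | [-> /SG2_1 {}SG2_1]]; last by rewrite SG1_1 SG2_1.
  by rewrite SG1_0 SG2_0 Nat.lxor_0_r.
- split=> [bal T k G p RT TG p01 | val T k G RT TG].
    have [SG1_0 SG1_1] := SG1_SG G.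
    have SG3_1 := balanced_SG3_1 T k G (fun k G => bal T k G RT) TG.
    case: p01 => ->; last by rewrite SG1_1 SG3_1.
    by rewrite SG1_0 SG3_0 Nat.lxor_0_r.
  apply/SG3_1_balanced => [G' G'_S1 |].
    by have [|_ ->] := val T k G' 1 RT (vertex_ordinary TG G'_S1); first by right.
  by have [|_ ->] := val T k G 1 RT TG; first by right.
Qed.
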